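(* (Conservative case) Let $v_-<v_*<v_+$ be real numbers and let $f$ be a smooth double-well potential which has two local minima at $v_-$ and $v_+$ and one local maximum at $v_*$, with $f'(v)>0$ for $v_-<v<v_*$ and $f'(v)<0$ for $v_*<v<v_+$. Suppose there are positive integers $m_1,m_2$ such that $$f^{(k)}(v_+)=0\ (1\le k\le 2m_1-1),\quad f^{(2m_1)}(v_+)>0,\qquad f^{(k)}(v_-)=0\ (1\le k\le 2m_2-1),\quad f^{(2m_2)}(v_-)>0.$$ Let $T_{11}$ be a given real constant. Then the one-dimensional system $$T_{11}=D^{11}_{11}u^1_{x_1}-(D^{11}:\varepsilon^{(0)})-(D^{11}:\varepsilon^{(1)})v,\qquad v_t=-\{(-f'(v)+v_{x_1x_1})_{x_1}|v_{x_1}|\}_{x_1}$$ for $(v,u^1)(x_1,t)$ admits a smooth traveling wave solution $(v,u^1_{x_1})=(v,w)(\xi)$, $\xi=x_1-st$, satisfying $$v(\xi)\to v_\pm,\quad w(\xi)\to w_\pm\quad\text{as }\xi\to\pm\infty,\qquad\text{and}\qquad v_\xi(\xi)>0\ \text{ for all }\xi\in\mathbb R,$$ if and only if the constants $s$, $v_\pm$ and $w_\pm$ satisfy the relations $$s=0,\qquad f(v_+)=f(v_-),\qquad D^{11}_{11}(w_+-w_-)=(D^{11}:\varepsilon^{(1)})(v_+-v_-).$$ In particular, the two local minima $f(v_\pm)$ must coincide also in this case, and necessarily $s=0$, so that the traveling wave is actually a standing wave solution. Moreover, such a standing wave solution is unique up to a translation in $\xi$ and verifies the decay estimates $$\big|\partial_\xi^k(v(\xi)-v_+)\big|\le\begin{cases}Ce^{-c|\xi|}&\text{if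 }m_1=1,\\ C(1+|\xi|)^{-\nu_1-k}&\text{if }m_1>1\end{cases}\qquad\text{for }\xi\to+\infty,$$ $$\big|\partial_\xi^k(v(\xi)-v_-)\big|\le\begin{cases}Ce^{-c|\xi|}&\text{if }m_2=1,\\ C(1+|\xi|)^{-\nu_2-k}&\text{if }m_2>1\end{cases}\qquad\text{for }\xi\to-\infty,$$ where $k$ is a non-negative integer, $\nu_1=1/(m_1-1)$, $\nu_2=1/(m_2-1)$, and $C$ and $c$ are positive constants.
   Context: $\mathcal S^n$ is the space of real symmetric $n\times n$ matrices, with scalar product $\sigma:\tau=\sum_{i,j=1}^n\sigma_{ij}\tau_{ij}$ and norm $|\sigma|=(\sigma:\sigma)^{1/2}$. $D=(D^{ij}_{kl})$ is a linear, symmetric, positive definite operator $\mathcal S^n\to\mathcal S^n$, acting by $(D\sigma)_{ij}=\sum_{k,l=1}^nD^{ij}_{kl}\sigma_{kl}$, with $(D\sigma):\sigma\ge c_0|\sigma|^2$ for some constant $c_0>0$. For fixed $(i,j)$, $D^{ij}=(D^{ij}_{kl})_{k,l}\in\mathcal S^n$. $\varepsilon^{(0)},\varepsilon^{(1)}\in\mathcal S^n$ are given constant matrices. For functions of the traveling wave form $v=v(x_1-st)$, $u^1_{x_1}=w(x_1-st)$ with constant velocity $s$, the system reads $$T_{11}=D^{11}_{11}w-(D^{11}:\varepsilon^{(0)})-(D^{11}:\varepsilon^{(1)})v,\qquad -sv_\xi=-\{(-f'(v)+v_{\xi\xi})_\xi|v_\xi|\}_\xi\quad(\xi\in\mathbb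 R).$$ A standing wave is a traveling wave with $s=0$.
   Formalization: The relations on the right of the ''if and only if'' also include T_11 = D^{11}_{11}w_- − (D^{11}:ε^{(0)}) − (D^{11}:ε^{(1)})v_-, since for given T_11 shifting w_- and w_+ by a common constant keeps the three relations but rules out any wave. *)

(* Defs.v *)
From HB Require Import structures.
From mathcomp Require Import all_boot all_order all_algebra.
From mathcomp Require Import all_classical all_reals all_analysis.

Set Implicit Arguments.
Unset Strict Implicit.
Unset Printing Implicit Defensive.

Import Order.TTheory GRing.Theory Num.Theory.
Import numFieldNormedType.Exports.

Local Open Scope classical_set_scope.
Local Open Scope ring_scope.

(* Matrices of size n.+1: the index 1 of the mathematical text is ord0. *)

Definition symm (R : realType) (n : nat) (A : 'M[R]_n) : Prop := A^T = A.

Definition ddot (R : realType) (n : nat) (A B : 'M[R]_n) : R :=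
  \sum_(i < n) \sum_(j < n) A i j * B i j.

Definition mnorm (R : realType) (n : nat) (A : 'M[R]_n) : R :=
  Num.sqrt (ddot A A).

(* D i j is the matrix D^{ij}, so that D^{ij}_{kl} is D i j k l. *)
Definition tensor_app (R : realType) (n : nat) (D : 'I_n -> 'I_n -> 'M[R]_n)
    (A : 'M[R]_n) : 'M[R]_n :=
  \matrix_(i, j) \sum_(k < n) \sum_(l < n) D i j k l * A k l.

Definition elasticity_tensor (R : realType) (n : nat)
    (D : 'I_n -> 'I_n -> 'M[R]_n) : Prop :=
  [/\ forall i j, symm (D i j),
      forall A, symm A -> symm (tensor_app D A),
      forall A B, symm A -> symm B ->
        ddot (tensor_app D A) B = ddot A (tensor_app D B)
    & exists2 c0 : R, 0 < c0 &
        forall A, symm A -> c0 * mnorm A ^+ 2 <= ddot (tensor_app D A) A].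

Definition smooth (R : realType) (g : R -> R) : Prop :=
  forall (k : nat) (x : R), derivable (derive1n k g) x 1.

Definition double_well (R : realType) (f : R -> R) (vm vs vp : R) : Prop :=
  [/\ smooth f,
      (\forall x \near vm, f vm <= f x) /\ (\forall x \near vp, f vp <= f x),
      \forall x \near vs, f x <= f vs,
      forall x, vm < x < vs -> 0 < derive1 f x
    & forall x, vs < x < vp -> derive1 f x < 0].

Definition min_order (R : realType) (f : R -> R) (a : R) (m : nat) : Prop :=
  (forall k : nat, (1 <= k <= (2 * m).-1)%N -> derive1n k f a = 0) /\
  0 < derive1n (2 * m) f a.

(* (-f'(V) + V_xx)_x |V_x| for V = V(x, t) *)
Definition flux (R : realType) (f : R -> R) (V : R -> R -> R) (x t : R) : R :=
  derive1 (fun y => - derive1 f (V y t) + derive1n 2 (V ^~ t) y) x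
    * `|derive1 (V ^~ t) x|.

(* The right-hand side of the first equation, with the value p for u_x and the
   value q for v. *)
Definition stress11 (R : realType) (n : nat)
    (D : 'I_n.+1 -> 'I_n.+1 -> 'M[R]_n.+1) (eps0 eps1 : 'M[R]_n.+1)
    (p q : R) : R :=
  D ord0 ord0 ord0 ord0 * p - ddot (D ord0 ord0) eps0
    - ddot (D ord0 ord0) eps1 * q.

(* (V, U)(x, t) is a classical solution of the one-dimensional system. As
   derive1 is total, the existence of the derivatives is required
   explicitly. *)
Definition solves_system (R : realType) (n : nat)
    (D : 'I_n.+1 -> 'I_n.+1 -> 'M[R]_n.+1) (eps0 eps1 : 'M[R]_n.+1)
    (T11 : R) (f : R -> R) (V U : R -> R -> R) : Prop :=
  forall x t : R,
    [/\ derivable (U ^~ t) x 1,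
        forall k : nat, (k <= 2)%N -> derivable (derive1n k (V ^~ t)) x 1,
        derivable (V x) t 1 /\ derivable (flux f V ^~ t) x 1,
        T11 = stress11 D eps0 eps1 (derive1 (U ^~ t) x) (V x t)
      & derive1 (V x) t = - derive1 (flux f V ^~ t) x].

(* (v, w) is the profile of a smooth monotone traveling wave (v, u_x) with
   speed s: only u_x, not the displacement u, is a function of x - s t. *)
Definition traveling_wave (R : realType) (n : nat)
    (D : 'I_n.+1 -> 'I_n.+1 -> 'M[R]_n.+1) (eps0 eps1 : 'M[R]_n.+1)
    (T11 : R) (f : R -> R) (s vm vp wm wp : R) (v w : R -> R) : Prop :=
  [/\ smooth v /\ smooth w,
      exists2 u : R -> R -> R,
        (forall x t, derive1 (u ^~ t) x = w (x - s * t)) &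
        solves_system D eps0 eps1 T11 f (fun x t => v (x - s * t)) u,
      (v x @[x --> -oo] --> vm) /\ (v x @[x --> +oo] --> vp),
      (w x @[x --> -oo] --> wm) /\ (w x @[x --> +oo] --> wp)
    & forall x, 0 < derive1 v x].

(* The k-th derivative of v - a decays at the filter F (-oo or +oo), at the
   rate attached to a minimum of order 2m; the rate c does not depend on k,
   the factor C does. *)
Definition decay_at (R : realType) (F : set_system R) (v : R -> R) (a : R)
    (m : nat) : Prop :=
  exists2 c : R, 0 < c & forall k : nat, exists2 C : R, 0 < C &
    \forall x \near F,
      `|derive1n k (fun y => v y - a) x| <=
        if m == 1%N then C * expR (- (c * `|x|))
        else C * (1 + `|x|) `^ (- (1 / (m%:R - 1)) - k%:R).

(* Main.v *)
Require Import Defs.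
From HB Require Import structures.
From mathcomp Require Import all_boot all_order all_algebra.
From mathcomp Require Import all_classical all_reals all_analysis.
From mathcomp Require Import ring lra zify.
Import Order.TTheory GRing.Theory Num.Theory.
Import numFieldNormedType.Exports.
Local Open Scope classical_set_scope.
Local Open Scope ring_scope.
Set Implicit Arguments.
Unset Strict Implicit.
Unset Printing Implicit Defensive.

(** A traveling wave is a heteroclinic orbit of a Newton equation.  Write the
    second equation of the system for the profile v, with v' > 0: integrated
    once, it says that the flux (v'' - f'(v))' v' equals s v + c for a constant
    c.  If this flux had a nonzero limit at an end, then g = v'' - f'(v) would
    tend to an infinity there, because g' = (s v + c) / v' and v' has a finite
    integral; as f'(v) stays bounded, v'' would tend to the same infinity, which
    a bounded monotone v does not allow ([tail_flux_lim]).  So the affine function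
    s v + c vanishes at both vm and vp, that is s = c = 0, and g is a constant,
    which is 0 since it is the limit of v''.  There remain v'' = f'(v) and the
    energy identities v'^2 = 2 (f(v) - f(vp)) = 2 (f(v) - f(vm)), obtained at the
    two ends; comparing them gives f(vp) = f(vm) ([wave_first_integrals]).

    Hence the profiles are exactly the solutions of the scalar autonomous
    equation v' = F(v), F = sqrt (2 (f - f(vm))), with values in ]vm, vp[, where F is
    positive.  The travel time Phi, an antiderivative of 1 / F, linearizes it:
    Phi(v(x)) = x + cst.  As Phi is injective this gives uniqueness up to a
    translation ([flow_unique]).  Since f'(vm) = f'(vp) = 0, F vanishes at least
    linearly at vm and vp, so Phi diverges logarithmically at both ends, is
    onto the line, and its inverse is a solution ([flow_exists]).  The component w
    is an affine function of v by the first equation, as D_1111 > 0.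

    For the decay, let z > 0 be the distance to an end state that is a minimum
    of order 2 m.  Then - z' is comparable to z^m, so z decays exponentially for m = 1,
    while z^(1 - m) grows at least linearly for m > 1.  The k-th derivative of z is
    a polynomial in z' and in the values along z of derivatives of f; give
    weight m to z' and 2 m - j to the j-th derivative of f.  Each differentiation
    raises the weight by m - 1, and an expression of weight p is O(z^p), so the
    k-th derivative of z is O(z^(1 + k (m - 1))) ([profile_derivative_bigO]). *)

(** * Derivatives and mean values *)

Section Calculus.
Variable R : realType.
Implicit Types (f g : R -> R) (x a b c : R).

Lemma is_deriveD_fun f g x a b : is_derive x 1 f a -> is_derive x 1 g b ->
  is_derive x 1 (fun y => f y + g y) (a + b).
Proof. by move=> hf hg; exact: (is_deriveD hf hg). Qed.

Lemma is_deriveM_fun f g x a b : is_derive x 1 f a -> is_derive x 1 g b ->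
  is_derive x 1 (fun y => f y * g y) (a * g x + f x * b).
Proof.
move=> hf hg; have h := is_deriveM hf hg.
apply: (is_derive_eq h); rewrite /GRing.scale /=; ring.
Qed.

Lemma is_deriveN_fun f x a : is_derive x 1 f a ->
  is_derive x 1 (fun y => - f y) (- a).
Proof. by move=> hf; exact: (is_deriveN hf). Qed.

Lemma is_deriveC_fun c x : is_derive x 1 (fun=> c) 0.
Proof. exact: is_derive_cst. Qed.

Lemma is_deriveZ_fun c f x a : is_derive x 1 f a ->
  is_derive x 1 (fun y => c * f y) (c * a).
Proof.
move=> hf; apply: (is_derive_eq (is_deriveM_fun (is_deriveC_fun c x) hf)).
by rewrite mul0r add0r.
Qed.

Lemma is_derive_chain f g x a b : is_derive (g x) 1 f a -> is_derive x 1 g b ->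
  is_derive x 1 (fun y => f (g y)) (a * b).
Proof. by move=> hf hg; exact: (@is_derive1_comp _ f g x a b hf hg). Qed.

Lemma is_deriveX_fun f x a n : is_derive x 1 f a ->
  is_derive x 1 (fun y => f y ^+ n) (n%:R * f x ^+ n.-1 * a).
Proof.
move=> hf; have h := is_deriveX n hf.
have -> : (fun y => f y ^+ n) = f ^+ n by apply/funext => y; rewrite exprfctE.
exact: h.
Qed.

Lemma is_derive_reflect f x a : is_derive (- x) 1 f a ->
  is_derive x 1 (fun y => f (- y)) (- a).
Proof.
move=> hf.
apply: (is_derive_eq (is_derive_chain hf (is_deriveN_fun (is_derive_id x 1)))).
by rewrite mulrN1.
Qed.

Lemma is_derive_derive1 f x a : is_derive x 1 f a -> derive1 f x = a.
Proof. by move=> [_ <-]; rewrite derive1E. Qed.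

Lemma is_derive_cont f x a : is_derive x 1 f a -> {for x, continuous f}.
Proof.
by move=> [df _]; exact/differentiable_continuous/derivable1_diffP.
Qed.

Lemma mean_value f g a b : a < b ->
  (forall x, a <= x <= b -> is_derive x 1 f (g x)) ->
  exists2 c, a < c < b & f b - f a = g c * (b - a).
Proof.
move=> ab fg.
have [x xab|x|c cab e] := @MVT _ f g a b ab.
- by apply: fg; move: xab; rewrite in_itv/= => /andP[/ltW-> /ltW->].
- apply: derivable_within_continuous => y; rewrite in_itv/= => yab.
  by case: (fg _ yab).
- by exists c => //; move: cab; rewrite in_itv.
Qed.

Lemma derive_ge0_le f g a b : a <= b ->
  (forall x, a <= x <= b -> is_derive x 1 f (g x)) ->
  (forall x, a < x < b -> 0 <= g x) -> f a <= f b.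
Proof.
rewrite le_eqVlt => /predU1P[->//|ab fg g0].
have [c cab e] := mean_value ab fg.
by rewrite -subr_ge0 e mulr_ge0 ?g0// subr_ge0 ltW.
Qed.

Lemma derive_eq0_cst f : (forall x, is_derive x 1 f 0) -> forall x, f x = f 0.
Proof. by move=> h x; exact: is_derive_0_is_cst. Qed.

Lemma slope_ge_unbounded f g (e M : R) : 0 < e ->
  (forall x, is_derive x 1 f (g x)) ->
  (\forall x \near +oo, e <= g x) -> \forall x \near +oo, M <= f x.
Proof.
move=> e0 fg [X [_ gX]].
exists (X + 1 + Num.max 0 ((M - f (X + 1)) / e)); split; first exact: num_real.
move=> x /= xX.
have h0 : 0 <= Num.max 0 ((M - f (X + 1)) / e) by rewrite le_max lexx.
have h1 : (M - f (X + 1)) / e <= Num.max 0 ((M - f (X + 1)) / e).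
  by rewrite le_max lexx orbT.
have h2 : M - f (X + 1) <= e * (x - (X + 1)).
  by rewrite mulrC -ler_pdivrMr//; lra.
have xX1 : X + 1 < x by lra.
have [c /andP[c1 c2] E] := @mean_value f g _ _ xX1 (fun y _ => fg y).
have : e <= g c by apply: gX; lra.
by nra.
Qed.

End Calculus.

(** * Behaviour at infinity of a decreasing positive function *)

(** Both ends of a wave are studied through the distance z of the profile to
    its end state, as a function of the distance travelled towards that end: it is
    positive, decreasing, and lives near + oo. *)
Section Tail.
Variable R : realType.
Variables z z1 z2 : R -> R.
Hypothesis z_gt0 : forall x, 0 < z x.
Hypothesis z1_lt0 : forall x, z1 x < 0.
Hypothesis zE : forall x : R, is_derive x 1 z (z1 x).
Hypothesis z1E : forall x : R, is_derive x 1 z1 (z2 x).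

(** Otherwise z1 would become positive. *)
Lemma tail_accel_not_pos e : 0 < e -> ~ \forall x \near +oo, e <= z2 x.
Proof.
move=> e0 /(slope_ge_unbounded 0 e0 z1E) h.
have [X X0] : exists x, 0 <= z1 x by exact: (@filter_ex _ +oo).
by have := z1_lt0 X; rewrite ltNge X0.
Qed.

(** Otherwise z1, then z itself, would tend to - oo. *)
Lemma tail_accel_not_neg e : 0 < e -> ~ \forall x \near +oo, z2 x <= - e.
Proof.
move=> e0 h.
have h1 : \forall x \near +oo, 1 <= - z1 x.
  apply: (@slope_ge_unbounded _ (fun x => - z1 x) (fun x => - z2 x) e) => //.
  by apply: filterS h => x; lra.
have h2 : \forall x \near +oo, 0 <= - z x.
  apply: (@slope_ge_unbounded _ (fun x => - z x) (fun x => - z1 x) 1) => //.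
have [X X0] : exists x, 0 <= - z x by exact: (@filter_ex _ +oo).
by have := z_gt0 X; rewrite -oppr_lt0 ltNge X0.
Qed.

(** A nonzero limit would keep the acceleration away from 0, with a fixed sign. *)
Lemma tail_accel_lim l : z2 x @[x --> +oo] --> l -> l = 0.
Proof.
move=> zl; apply/eqP; case: (ltrgtP l 0) => // l0; exfalso.
  have e0 : 0 < - l / 2 by lra.
  apply: (tail_accel_not_neg e0).
  have : \forall x \near +oo, z2 x < l / 2 by apply: (cvgr_lt l) => //; lra.
  by apply: filterS => x; lra.
have e0 : 0 < l / 2 by lra.
apply: (tail_accel_not_pos e0).
have : \forall x \near +oo, l / 2 < z2 x by apply: (cvgr_gt l) => //; lra.
by apply: filterS => x; lra.
Qed.

(** Suppose the flux z1 * g1 has a limit l < 0 and put d = - l / 2.  Far out,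
    g1 = (z1 * g1) / z1 >= d / (- z1) >= d * (2 + z1), by 1 / q >= 2 - q; hence
    g - d * z has slope at least 2 * d and tends to + oo, so do g and the
    acceleration z2, which is impossible.  The case l > 0 is symmetric. *)
Lemma tail_flux_lim (g g1 k : R -> R) (l : R) :
  (forall x : R, is_derive x 1 g (g1 x)) ->
  (forall x, z2 x = g x + k x) ->
  k x @[x --> +oo] --> 0 ->
  (z1 x * g1 x) @[x --> +oo] --> l -> l = 0.
Proof.
move=> gE z2E k0 fl; apply/eqP; case: (ltrgtP l 0) => // l0; exfalso.
  pose d := - l / 2; have d0 : 0 < d by rewrite /d; lra.
  have h : \forall x \near +oo, 2 <= g x + (- d) * z x.
    apply: (@slope_ge_unbounded _ _ (fun x => g1 x + (- d) * z1 x) (2 * d)); first by lra.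
    have : \forall x \near +oo, z1 x * g1 x < - d.
      by apply: (cvgr_lt l) => //; rewrite /d; lra.
    apply: filterS => x hx; have q0 := z1_lt0 x.
    have : 0 < g1 x by nra.
    have : 0 <= (1 + z1 x) ^+ 2 by exact: sqr_ge0.
    by nra.
  have hk : \forall x \near +oo, - 1 < k x by apply: (cvgr_gt 0) => //; lra.
  apply: (tail_accel_not_pos ltr01).
  near=> x; rewrite z2E.
  have h1 : 2 <= g x + (- d) * z x by near: x.
  have h2 : -1 < k x by near: x.
  have := z_gt0 x; by nra.
pose d := l / 2; have d0 : 0 < d by rewrite /d; lra.
have h : \forall x \near +oo, 2 <= - g x + (- d) * z x.
  apply: (@slope_ge_unbounded _ _ (fun x => - g1 x + (- d) * z1 x) (2 * d)); first by lra.
  have : \forall x \near +oo, d < z1 x * g1 x.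
    by apply: (cvgr_gt l) => //; rewrite /d; lra.
  apply: filterS => x hx; have q0 := z1_lt0 x.
  have : g1 x < 0 by nra.
  have : 0 <= (1 + z1 x) ^+ 2 by exact: sqr_ge0.
  by nra.
have hk : \forall x \near +oo, k x < 1 by apply: (cvgr_lt 0) => //; lra.
apply: (tail_accel_not_neg ltr01).
near=> x; rewrite z2E.
have h1 : 2 <= - g x + (- d) * z x by near: x.
have h2 : k x < 1 by near: x.
have := z_gt0 x; by nra.
Unshelve. all: by end_near. Qed.

(** A positive limit of z1 ^+ 2 would make z decrease at a fixed rate. *)
Lemma tail_speed_lim (l : R) : (z1 x ^+ 2) @[x --> +oo] --> l -> l = 0.
Proof.
move=> zl; apply/eqP; case: (ltrgtP l 0) => // l0; exfalso.
  have h : \forall x \near +oo, z1 x ^+ 2 < 0 by exact: (cvgr_lt l).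
  have [X] := filter_ex h.
  by rewrite ltNge sqr_ge0.
have h : \forall x \near +oo, l / 2 < z1 x ^+ 2 by apply: (cvgr_gt l) => //; lra.
pose e := Num.min 1 (l / 2).
have e0 : 0 < e by rewrite lt_min; apply/andP; split; lra.
have h2 : \forall x \near +oo, 0 <= - z x.
  apply: (@slope_ge_unbounded _ (fun x => - z x) (fun x => - z1 x) e) => //.
  near=> x; have hx : l / 2 < z1 x ^+ 2 by near: x.
  have e1 : e <= 1 by rewrite ge_min lexx.
  have e2 : e <= l / 2 by rewrite ge_min lexx orbT.
  have z0 := z1_lt0 x.
  by rewrite leNgt; apply/negP => ?; nra.
have [X X0] : exists x, 0 <= - z x by exact: (@filter_ex _ +oo).
by have := z_gt0 X; rewrite -oppr_lt0 ltNge X0.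
Unshelve. all: by end_near. Qed.

End Tail.

(** * First integrals of the profile equation *)

Section FirstIntegrals.
Variable R : realType.

Lemma cvg_comp_continuous (F : set_system R) (FF : Filter F) (h z : R -> R) (a : R) :
  {for a, continuous h} -> z x @[x --> F] --> a -> h (z x) @[x --> F] --> h a.
Proof. by move=> hc za; exact: (@cvg_comp _ _ _ z h F _ _ za hc). Qed.

(** The flux is affine in v, with slope s.  It tends to 0 at both ends, where v
    has distinct limits, so s = 0 and the flux vanishes identically.  Then
    v'' - f'(v) is constant, and the constant is 0 because v'' cannot have another
    limit; the energy v'^2 / 2 - f(v) is conserved, and since v' tends to 0 its
    value can be read at either end. *)
Lemma wave_first_integrals (f f1 f2 v v1 v2 v3 : R -> R) (s vm vp : R) :
  (forall x : R, is_derive x 1 f (f1 x)) ->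
  (forall x : R, is_derive x 1 f1 (f2 x)) ->
  f1 vm = 0 -> f1 vp = 0 -> vm < vp ->
  (forall x : R, is_derive x 1 v (v1 x)) ->
  (forall x : R, is_derive x 1 v1 (v2 x)) ->
  (forall x : R, is_derive x 1 v2 (v3 x)) ->
  v x @[x --> -oo] --> vm -> v x @[x --> +oo] --> vp ->
  (forall x, 0 < v1 x) -> (forall x, vm < v x < vp) ->
  (forall x : R, is_derive x 1 (fun y => (- (f2 (v y) * v1 y) + v3 y) * v1 y)
                             (s * v1 x)) ->
  [/\ s = 0, forall x, v2 x = f1 (v x),
      forall x, v1 x ^+ 2 = 2 * (f (v x) - f vp) &
      forall x, v1 x ^+ 2 = 2 * (f (v x) - f vm)].
Proof.
move=> fE f1E f1m f1p vmp vE v1E v2E vlm vlp v10 vb fluxE.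
pose J y := (- (f2 (v y) * v1 y) + v3 y) * v1 y.
have [c Jc] : exists c, forall x, J x = s * v x + c.
  exists (J 0 - s * v 0) => x.
  have h := @derive_eq0_cst _ (fun y => J y + (- s) * v y) _ x.
  suff : J x + - s * v x = J 0 + - s * v 0 by lra.
  apply: h => y.
  apply: (is_derive_eq (is_deriveD_fun (fluxE y) (is_deriveZ_fun (- s) (vE y)))).
  by ring.
have vlm' : v (- x) @[x --> +oo] --> vm by apply/cvgNy_compNP.
have f1c a : {for a, continuous f1} by exact: is_derive_cont (f1E a).
have fc a : {for a, continuous f} by exact: is_derive_cont (fE a).
have f1vp : f1 (v x) @[x --> +oo] --> 0 by rewrite -f1p; exact: cvg_comp_continuous.
have f1vm : f1 (v (- x)) @[x --> +oo] --> 0.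
  rewrite -f1m.
    exact: (@cvg_comp_continuous +oo _ _ (fun x => v (- x)) vm (f1c _) vlm').
(* the distances to the two end states, both read towards + oo *)
pose p x := vp - v x; pose m x := v (- x) - vm.
have p0 x : 0 < p x by have := vb x; rewrite /p; lra.
have m0 x : 0 < m x by have := vb (- x); rewrite /m; lra.
have p10 x : - v1 x < 0 by have := v10 x; lra.
have m10 x : - v1 (- x) < 0 by have := v10 (- x); lra.
have pE (x : R) : is_derive x 1 p (- v1 x).
  apply: (is_derive_eq (is_deriveD_fun (is_deriveC_fun vp x) (is_deriveN_fun (vE x)))).
  by rewrite add0r.
have p1E (x : R) : is_derive x 1 (fun y => - v1 y) (- v2 x) by exact: is_deriveN_fun.
have mE (x : R) : is_derive x 1 m (- v1 (- x)).
  apply: (is_derive_eq (is_deriveD_fun (is_derive_reflect (vE (- x)))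
    (is_deriveC_fun (- vm) x))).
  by rewrite addr0.
have m1E (x : R) : is_derive x 1 (fun y => - v1 (- y)) (v2 (- x)).
  apply: (is_derive_eq (is_deriveN_fun (is_derive_reflect (v1E (- x))))).
  by rewrite opprK.
have gE (x : R) : is_derive x 1 (fun y => - f1 (v y) + v2 y)
    (- (f2 (v x) * v1 x) + v3 x).
  exact: (is_deriveD_fun (is_deriveN_fun (is_derive_chain (f1E _) (vE x)))).
have cp : s * vp + c = 0.
  apply: (@tail_flux_lim _ p (fun x => - v1 x) (fun x => - v2 x) p0 p10 pE p1E
    (fun x => - (- f1 (v x) + v2 x))
    (fun x => - (- (f2 (v x) * v1 x) + v3 x)) (fun x => - f1 (v x))).
  - by move=> x; lra.
  - by rewrite -oppr0; apply: cvgN.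
  rewrite (_ : (fun x => _) = fun x => s * v x + c); last first.
    by apply/funext => x; rewrite -Jc /J; ring.
  by apply: cvgD; [apply: cvgMr|exact: cvg_cst].
have cm : s * vm + c = 0.
  apply: (@tail_flux_lim _ m (fun x => - v1 (- x)) (fun x => v2 (- x)) m0 m10 mE m1E
    (fun x => - f1 (v (- x)) + v2 (- x))
    (fun x => - (- (f2 (v (- x)) * v1 (- x)) + v3 (- x))) (fun x => f1 (v (- x)))).
  - by move=> x; apply: (is_derive_reflect (gE (- x))).
  - by move=> x; lra.
  - by [].
  rewrite (_ : (fun x => _) = fun x => s * v (- x) + c); last first.
    by apply/funext => x; rewrite -Jc /J; ring.
  by apply: cvgD; [apply: cvgMr|exact: cvg_cst].
have s0 : s = 0.
  have : s * (vp - vm) = 0 by lra.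
  by move/eqP; rewrite mulf_eq0 => /orP[/eqP//|]; lra.
have c0 : c = 0 by move: cp; rewrite s0; lra.
have J0 x : - (f2 (v x) * v1 x) + v3 x = 0.
  have := Jc x; rewrite s0 c0 mul0r addr0 => /eqP; rewrite mulf_eq0.
  by rewrite (gt_eqF (v10 x)) orbF => /eqP.
pose g0 := - f1 (v 0) + v2 0.
have gc x : - f1 (v x) + v2 x = g0.
  by apply: (derive_eq0_cst (f := fun y => - f1 (v y) + v2 y)) => y; rewrite -(J0 y).
have g00 : g0 = 0.
  suff : - g0 = 0 by lra.
  apply: (@tail_accel_lim _ p (fun x => - v1 x) (fun x => - v2 x) p0 p10 pE p1E).
  rewrite (_ : (fun x => _) = fun x => - f1 (v x) - g0); last first.
    by apply/funext => x; rewrite -(gc x); ring.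
  rewrite -[X in _ --> X]add0r; apply: cvgB; last exact: cvg_cst.
  by rewrite -oppr0; apply: cvgN.
have v2f x : v2 x = f1 (v x) by have := gc x; rewrite g00; lra.
have E (x : R) : is_derive x 1 (fun y => v1 y ^+ 2 + (- 2) * f (v y)) 0.
  apply: (is_derive_eq (is_deriveD_fun (is_deriveX_fun 2 (v1E x))
    (is_deriveZ_fun (- 2) (is_derive_chain (fE (v x)) (vE x))))).
  by rewrite v2f /=; ring.
pose e := v1 0 ^+ 2 + (- 2) * f (v 0).
have Ec x : v1 x ^+ 2 + (- 2) * f (v x) = e by exact: (derive_eq0_cst E).
have v1sq x : v1 x ^+ 2 = e + 2 * f (v x) by have := Ec x; lra.
split => //.
- have ep : e + 2 * f vp = 0.
    apply: (@tail_speed_lim _ p (fun x => - v1 x) p0 p10 pE).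
    rewrite (_ : (fun x => _) = fun x => e + 2 * f (v x)); last first.
      by apply/funext => x; rewrite sqrrN v1sq.
    apply: cvgD; first exact: cvg_cst.
    by apply: cvgMr; exact: cvg_comp_continuous.
  by move=> x; rewrite v1sq; lra.
- have ep : e + 2 * f vm = 0.
    apply: (@tail_speed_lim _ m (fun x => - v1 (- x)) m0 m10 mE).
    rewrite (_ : (fun x => _) = fun x => e + 2 * f (v (- x))); last first.
      by apply/funext => x; rewrite sqrrN v1sq.
    apply: cvgD; first exact: cvg_cst.
    apply: cvgMr.
    exact: (@cvg_comp_continuous +oo _ _ (fun x => v (- x)) vm (fc _) vlm').
  by move=> x; rewrite v1sq; lra.
Qed.

End FirstIntegrals.

(** * Functions vanishing to a finite order *)

Section Towers.
Variable R : realType.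

(** A smooth function given together with all its derivatives.  Unlike
    iterated [derive1n], this is stable by affine changes of variable and
    sums, with explicit formulas for the derivatives. *)
Definition derivative_tower (G : nat -> R -> R) : Prop :=
  forall (k : nat) (x : R), is_derive x 1 (G k) (G k.+1 x).

Lemma smooth_tower (g : R -> R) : smooth g -> derivative_tower (fun k => derive1n k g).
Proof.
move=> gs k x; have := derivableP (gs k x).
by rewrite derive1nS derive1E.
Qed.

Lemma tower_derive1n (G : nat -> R -> R) k :
  derivative_tower G -> derive1n k (G 0%N) = G k.
Proof.
move=> GE; elim: k => [|k IH]; first by rewrite derive1n0.
by rewrite derive1nS IH; apply/funext => x; exact: is_derive_derive1.
Qed.

Lemma tower_smooth (G : nat -> R -> R) : derivative_tower G -> smooth (G 0%N).
Proof. by move=> GE k x; rewrite (tower_derive1n _ GE); case: (GE k x). Qed.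

Lemma tower_shift G : derivative_tower G -> derivative_tower (fun k => G k.+1).
Proof. by move=> GE k x; exact: GE. Qed.

Lemma tower_opp G : derivative_tower G -> derivative_tower (fun k y => - G k y).
Proof. by move=> GE k x; exact: is_deriveN_fun. Qed.

Lemma tower_cont G k : derivative_tower G -> continuous (G k).
Proof. by move=> GE x; exact: (is_derive_cont (GE k x)). Qed.

(** One-sided Taylor bound, obtained by integrating the bound on the p-th derivative
    p times.  Any c below the p-th derivative at 0 is allowed, negative or
    not, so that it yields lower bounds for G and, applied to - G, upper
    bounds. *)
Lemma tower_lower G p c : derivative_tower G -> 
  (forall i, (i < p)%N -> G i 0 = 0) -> c < G p 0 ->
  exists2 d, 0 < d & forall y, 0 <= y <= d -> c / p`!%:R * y ^+ p <= G 0%N y.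
Proof.
elim: p G => [|p IH] G GE G0 cG.
  have Gc : G 0%N y @[y --> (0 : R)] --> G 0%N 0 by exact: tower_cont.
  have : \forall y \near (0 : R), c < G 0%N y by exact: (cvgr_gt _ Gc).
  move=> /nbhs_ballP[e /= e0 he]; exists (e / 2); first lra.
  move=> y y0; rewrite fact0 divr1 expr0 mulr1; apply/ltW/he.
  by rewrite /ball /= sub0r normrN ger0_norm; lra.
have [|d d0 hd] := IH _ (tower_shift GE) _ cG; first by move=> i ip; exact: G0.
exists d => // y /andP[y0 yd].
pose h (x : R) := G 0%N x + (- (c / p.+1`!%:R)) * x ^+ p.+1.
suff : h 0 <= h y.
  by rewrite /h expr0n /= mulr0 addr0 G0//; lra.
have pn0 : (p`!%:R : R) != 0 by rewrite pnatr_eq0 -lt0n fact_gt0.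
have p1n0 : (p.+1%:R : R) != 0 by rewrite pnatr_eq0.
apply: (@derive_ge0_le _ _ (fun x => G 1%N x - c / p`!%:R * x ^+ p)) => // x hx.
  apply: (is_derive_eq (is_deriveD_fun (GE 0%N x)
    (is_deriveZ_fun (- (c / p.+1`!%:R)) (is_deriveX_fun p.+1 (is_derive_id x 1))))).
  rewrite factS natrM /=; field.
  by rewrite pn0 nat1r p1n0.
by rewrite subr_ge0; apply: hd; lra.
Qed.

Lemma tower_bigO G p : derivative_tower G ->
  (forall i, (i < p)%N -> G i 0 = 0) ->
  exists2 C, 0 < C & exists2 d, 0 < d & 
    forall y, 0 <= y <= d -> `|G 0%N y| <= C * y ^+ p.
Proof.
move=> GE G0; pose c := `|G p 0| + 1.
have [|d1 d10 h1] := @tower_lower G p (- c) GE G0.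
  by have := ler_norm (- G p 0); rewrite normrN /c; lra.
have [||d2 d20 h2] := @tower_lower _ p (- c) (tower_opp GE).
- by move=> i ip; rewrite G0 ?oppr0.
- by have := ler_norm (G p 0); rewrite /c; lra.
have f0 : 0 < (p`!%:R : R) by rewrite ltr0n fact_gt0.
have c0 : 0 < c by rewrite /c; have := normr_ge0 (G p 0); lra.
exists (c / p`!%:R); first by rewrite divr_gt0.
exists (Num.min d1 d2); first by rewrite lt_min d10.
move=> y; rewrite le_min => /andP[y0 /andP[y1 y2]].
rewrite ler_norml; have := h1 y; have := h2 y; rewrite y0 y1 y2 => /(_ isT) + /(_ isT).
by rewrite !mulNr; lra.
Qed.

End Towers.

(** * Decay of a profile towards a degenerate minimum *)

(** z is the distance to the end state, read towards + oo, and G 0 is the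
    potential in the variable z, normalized to vanish at 0: z obeys the Newton
    equation z'' = G'(z) with zero energy. *)
Section Decay.
Variable R : realType.
Variables (G : nat -> R -> R) (z z1 : R -> R) (m : nat).
Hypothesis GE : derivative_tower G.
Hypothesis zE : forall x : R, is_derive x 1 z (z1 x).
Hypothesis z1E : forall x : R, is_derive x 1 z1 (G 1%N (z x)).
Hypothesis m_gt0 : (0 < m)%N.

(** The differential polynomials in z that occur as derivatives of z, with a
    lower bound for their weight.  The weight 2 m - j of a derivative of order
    j > 2 m is truncated to 0, in accordance with the order of vanishing of that
    derivative; this is harmless as weights may always be lowered. *)
Inductive weighted : nat -> (R -> R) -> Prop :=
| weighted_force j : weighted (2 * m - j.+1) (fun x => G j.+1 (z x))
| weighted_speed : weighted m z1
| weightedD p f g : weighted p f -> weighted p g ->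
    weighted p (fun x => f x + g x)
| weightedM p r f g : weighted p f -> weighted r g ->
    weighted (p + r) (fun x => f x * g x)
| weighted_le p r f : (p <= r)%N -> weighted r f -> weighted p f.

(** Differentiating z1 turns the weight m into 2 m - 1, and differentiating
    G j (z) replaces 2 m - j by (2 m - j - 1) + m: both gain m - 1. *)
Lemma weighted_derive p f : weighted p f ->
  exists2 f1, weighted (p + m.-1) f1 & forall x : R, is_derive x 1 f (f1 x).
Proof.
elim=> {p f} [j||p f g _ [f1 f1W f1E] _ [g1 g1W g1E]
             |p r f g fW [f1 f1W f1E] gW [g1 g1W g1E]|p r f pr _ [f1 f1W f1E]].
- exists (fun x => G j.+2 (z x) * z1 x).
    apply: (weighted_le _ (weightedM (weighted_force j.+1) weighted_speed)).
    by move: m_gt0; lia.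
  by move=> x; exact: is_derive_chain (GE _ _) (zE x).
- exists (fun x => G 1%N (z x)) => //.
  by apply: (weighted_le _ (weighted_force 0)); move: m_gt0; lia.
- exists (fun x => f1 x + g1 x); first exact: weightedD.
  by move=> x; exact: is_deriveD_fun.
- exists (fun x => f1 x * g x + f x * g1 x).
    apply: weightedD.
      by apply: (weighted_le _ (weightedM f1W gW)); lia.
    by apply: (weighted_le _ (weightedM fW g1W)); lia.
  by move=> x; exact: is_deriveM_fun.
- by exists f1 => //; apply: (weighted_le _ f1W); lia.
Qed.

Lemma profile_derivative k :
  weighted (1 + k.+1 * m.-1) (derive1n k.+1 z) /\
  forall x : R, derivable (derive1n k z) x 1.
Proof.
elim: k => [|k [IH _]].
  split; last by move=> x; case: (zE x).
  have -> : derive1n 1 z = z1 by apply/funext => x; exact: is_derive_derive1.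
  by apply: (weighted_le _ weighted_speed); move: m_gt0; lia.
have [f1 f1W f1E] := weighted_derive IH; split.
  have -> : derive1n k.+2 z = f1.
    by apply/funext => x; rewrite derive1nS; exact: is_derive_derive1.
  by apply: (weighted_le _ f1W); lia.
by move=> x; case: (f1E x).
Qed.

Lemma profile_smooth : smooth z.
Proof. by move=> k; case: (profile_derivative k). Qed.

Hypothesis G0 : forall i, (i < 2 * m)%N -> G i 0 = 0.
Hypothesis z_gt0 : forall x, 0 < z x.
Hypothesis z1_lt0 : forall x, z1 x < 0.
Hypothesis z_lim : z x @[x --> +oo] --> 0.
Hypothesis energy : forall x, z1 x ^+ 2 = 2 * G 0%N (z x).

Let z_lt (d : R) : 0 < d -> \forall x \near +oo, z x < d.
Proof. by move=> d0; exact: (cvgr_lt 0). Qed.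

Lemma tower_bigO_profile j : exists2 C, 0 < C &
  \forall x \near +oo, `|G j (z x)| <= C * z x ^+ (2 * m - j).
Proof.
have shift i : derivative_tower (fun k => G (i + k)%N).
  by move=> k x; rewrite addnS; exact: GE.
have [i ij|C C0 [d d0 h]] := tower_bigO (shift j) (p := 2 * m - j).
  by apply: G0; lia.
exists C => //; near=> x; rewrite -{1}[j]addn0; apply: h.
by rewrite (ltW (z_gt0 x)) /=; apply/ltW; near: x; exact: z_lt.
Unshelve. all: by end_near. Qed.

(** By conservation of energy, the speed is the square root of a function
    that vanishes to order 2 m. *)
Lemma speed_bigO : exists2 C, 0 < C &
  \forall x \near +oo, `|z1 x| <= C * z x ^+ m.
Proof.
have [C C0 h] := tower_bigO_profile 0.
exists (Num.sqrt (2 * C)); first by rewrite sqrtr_gt0; lra.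
near=> x.
have hx : `|G 0%N (z x)| <= C * z x ^+ (2 * m - 0) by near: x.
have zm : 0 <= z x ^+ m by rewrite exprn_ge0 // ltW.
rewrite -(@ler_pXn2r _ 2) ?nnegrE ?mulr_ge0 ?sqrtr_ge0//.
rewrite real_normK ?num_real// energy exprMn sqr_sqrtr; last lra.
rewrite -exprM mulnC -mulrA; rewrite subn0 in hx.
by have := ler_norm (G 0%N (z x)); lra.
Unshelve. all: by end_near. Qed.

Lemma weighted_bigO p f : weighted p f -> exists2 C, 0 < C &
  \forall x \near +oo, `|f x| <= C * z x ^+ p.
Proof.
elim=> {p f} [j||p f g _ [C C0 fC] _ [D D0 gD]
             |p r f g _ [C C0 fC] _ [D D0 gD]|p r f pr _ [C C0 fC]].
- exact: tower_bigO_profile.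
- exact: speed_bigO.
- exists (C + D); first lra.
  near=> x.
  have h1 : `|f x| <= C * z x ^+ p by near: x.
  have h2 : `|g x| <= D * z x ^+ p by near: x.
  by have := ler_normD (f x) (g x); lra.
- exists (C * D); first by rewrite mulr_gt0.
  near=> x.
  rewrite normrM exprD mulrACA ler_pM//; by near: x.
- exists C => //; near=> x.
  have h1 : `|f x| <= C * z x ^+ r by near: x.
  apply: (le_trans h1); rewrite ler_pM2l//.
  apply: ler_wiXn2l => //; first exact/ltW.
  by apply/ltW; near: x; exact: z_lt.
Unshelve. all: by end_near. Qed.

Lemma profile_derivative_bigO k : exists2 C, 0 < C &
  \forall x \near +oo, `|derive1n k z x| <= C * z x ^+ (1 + k * m.-1).
Proof.
case: k => [|k]; last exact: weighted_bigO (profile_derivative k).1.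
exists 1 => //; near=> x.
by rewrite derive1n0 mul1r mul0n addn0 expr1 ger0_norm// ltW.
Unshelve. all: by end_near. Qed.

Hypothesis Gtop : 0 < G (2 * m)%N 0.

Lemma speed_lower : exists2 c, 0 < c &
  \forall x \near +oo, c * z x ^+ m <= - z1 x.
Proof.
have [t t0 tG] : exists2 t, 0 < t & t < G (2 * m)%N 0.
  by move: Gtop; move: (G _ _) => t t0; exists (t / 2); lra.
have [d d0 h] := tower_lower GE G0 tG.
have f0 : 0 < ((2 * m)`!%:R : R) by rewrite ltr0n fact_gt0.
have c0 : 0 < t / (2 * m)`!%:R by rewrite divr_gt0.
exists (Num.sqrt (t / (2 * m)`!%:R)); first by rewrite sqrtr_gt0.
near=> x.
have zm : 0 <= z x ^+ m by rewrite exprn_ge0 // ltW.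
rewrite -(@ler_pXn2r _ 2) ?nnegrE ?mulr_ge0 ?sqrtr_ge0//; last first.
  by rewrite oppr_ge0 ltW.
rewrite sqrrN energy exprMn sqr_sqrtr ?(ltW c0)// -exprM [(m * 2)%N]mulnC.
have : 0 <= z x <= d.
  by rewrite (ltW (z_gt0 x)) /=; apply/ltW; near: x; exact: z_lt.
move=> /h; move: (t / _ * _) => e; have := sqr_ge0 (z1 x); rewrite energy.
by move: (G _ _) => w; lra.
Unshelve. all: by end_near. Qed.

(** From z1 <= - c * z, the function z * exp (c * x) is nonincreasing. *)
Lemma exp_decay : m = 1%N -> exists2 c, 0 < c & exists2 A, 0 < A &
  \forall x \near +oo, z x <= A * expR (- (c * x)).
Proof.
move=> m1; have [c c0 [X [_ hX]]] := speed_lower.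
exists c => //; exists (z (X + 1) * expR (c * (X + 1))).
  by rewrite mulr_gt0 ?expR_gt0.
exists (X + 1); split; first exact: num_real.
move=> x /= xX.
rewrite expRN ler_pdivlMr ?expR_gt0//.
pose h x := - (z x * expR (c * x)).
suff : h (X + 1) <= h x by rewrite /h; lra.
have eE (y : R) : is_derive y 1 (fun t => expR (c * t)) (expR (c * y) * (c * 1)).
  exact: is_derive_chain (is_derive_expR _) (is_deriveZ_fun c (is_derive_id y 1)).
apply: (derive_ge0_le (ltW xX)
  (fun y _ => is_deriveN_fun (is_deriveM_fun (zE y) (eE y)))) => y /andP[yX _].
have Xy : X < y by lra.
have := hX y Xy; rewrite m1 expr1 => hy.
by have := expR_gt0 (c * y); nra.
Qed.

(** From z1 <= - c * z ^+ m, the function 1 / z ^+ (m - 1) has slope at least c. *)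
Lemma power_decay : (1 < m)%N -> exists2 B, 0 < B &
  \forall x \near +oo, z x ^+ m.-1 <= B / (1 + x).
Proof.
move=> m1; have [c c0 [X [_ hX]]] := speed_lower.
exists (2 / c); first by rewrite divr_gt0.
pose w1 x := m.-1%:R * (- z1 x / z x ^+ m).
have wE (x : R) : is_derive x 1 (fun y => (z y ^+ m.-1)^-1) (w1 x).
  have zn k : z x ^+ k != 0 by rewrite expf_neq0// gt_eqF.
  have h := @is_deriveV _ (fun y => z y ^+ m.-1) x _ 1 (zn m.-1)
    (is_deriveX_fun m.-1 (zE x)).
  apply: (is_derive_eq h).
  have mE : z x ^+ m = z x ^+ m.-1.-1 * z x ^+ 2.
    by rewrite -exprD; congr (_ ^+ _); move: m1; lia.
  have m1E : z x ^+ m.-1 = z x ^+ m.-1.-1 * z x.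
    by rewrite -exprSr; congr (_ ^+ _); move: m1; lia.
  rewrite /w1 mE m1E /GRing.scale /=.
  field.
  by rewrite zn (gt_eqF (z_gt0 x)).
have w1c x : X < x -> c <= w1 x.
  move=> /hX hx; have zm0 : 0 < z x ^+ m by rewrite exprn_gt0.
  have n1 : 1 <= (m.-1%:R : R) by rewrite ler1n; move: m1; lia.
  have : c <= - z1 x / z x ^+ m by rewrite ler_pdivlMr.
  by rewrite /w1; move: (m.-1%:R) n1 (_ / _) => n n1 q cq; nra.
near=> x.
have xX : X + 1 < x by near: x; exact: nbhs_pinfty_gt (num_real _).
have x0 : 0 < x by near: x; exact: nbhs_pinfty_gt (num_real _).
have x2 : 2 * X + 3 < x by near: x; exact: nbhs_pinfty_gt (num_real _).
have zn0 : 0 < z x ^+ m.-1 by rewrite exprn_gt0.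
have [t /andP[t1 t2] e] := mean_value xX (fun y _ => wE y).
have wX : 0 < (z (X + 1) ^+ m.-1)^-1 by rewrite invr_gt0 exprn_gt0.
have ct : c <= w1 t by apply: w1c; lra.
rewrite ler_pdivlMr; last lra.
(* x > 2 X + 3 gives x - (X + 1) >= (1 + x) / 2 *)
rewrite ler_pdivlMr//.
have zb : z x ^+ m.-1 * (z x ^+ m.-1)^-1 = 1 by rewrite mulfV// gt_eqF.
have hb : c * (1 + x) <= 2 * (z x ^+ m.-1)^-1.
  move: e wX ct => /=; move: (w1 t) (z x ^+ _)^-1 (z (X + 1) ^+ _)^-1 => a b b' e wX ct.
  have : c * (x - (X + 1)) <= a * (x - (X + 1)) by rewrite ler_wpM2r//; lra.
  by nra.
by move: zb hb zn0; move: (z x ^+ _) (z x ^+ _)^-1 => q b zb hb q0; nra.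
Unshelve. all: by end_near. Qed.

Lemma profile_decay : exists2 c, 0 < c & forall k : nat, exists2 C, 0 < C &
  \forall x \near +oo, `|derive1n k z x| <=
    if m == 1%N then C * expR (- (c * `|x|))
    else C * (1 + `|x|) `^ (- (1 / (m%:R - 1)) - k%:R).
Proof.
case: (eqVneq m 1%N) => [m1|m1].
  have [c c0 [A A0 zA]] := exp_decay m1.
  exists c => // k; have [C C0 kC] := profile_derivative_bigO k.
  exists (C * A); first by rewrite mulr_gt0.
  near=> x.
  have x0 : 0 < x by near: x; exact: nbhs_pinfty_gt (num_real _).
  have h1 : `|derive1n k z x| <= C * z x ^+ (1 + k * m.-1) by near: x.
  rewrite m1 muln0 expr1 in h1.
  apply: (le_trans h1); rewrite -mulrA ler_pM2l// gtr0_norm//.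
  by near: x.
have mgt1 : (1 < m)%N by move: m1 m_gt0; lia.
have [B B0 zB] := power_decay mgt1.
exists 1 => // k; have [C C0 kC] := profile_derivative_bigO k.
have mE : (m%:R : R) - 1 = m.-1%:R by rewrite -[in LHS](prednK m_gt0) -natr1 addrK.
have n0 : (m.-1%:R : R) != 0 by rewrite pnatr_eq0; move: mgt1; lia.
pose r : R := 1 / (m%:R - 1) + k%:R.
have r0 : 0 <= r by rewrite /r mE addr_ge0// divr_ge0.
exists (C * B `^ r); first by rewrite mulr_gt0// powR_gt0.
near=> x.
have x0 : 0 < x by near: x; exact: nbhs_pinfty_gt (num_real _).
have h1 : `|derive1n k z x| <= C * z x ^+ (1 + k * m.-1) by near: x.
have h2 : z x ^+ m.-1 <= B / (1 + x) by near: x.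
apply: (le_trans h1); rewrite -mulrA ler_pM2l// gtr0_norm//.
have zr : z x ^+ (1 + k * m.-1) = (z x ^+ m.-1) `^ r.
  rewrite -!powR_mulrn ?(ltW (z_gt0 x))// -powRrM; congr (_ `^ _).
  rewrite natrD natrM /r mE; field.
  by [].
have -> : - (1 / (m%:R - 1)) - k%:R = - 1 * r by rewrite /r; ring.
rewrite zr powRrM powR_inv1; last lra.
rewrite -powRM ?invr_ge0; [|lra|lra].
apply: ge0_ler_powR => //; rewrite nnegrE; first by rewrite exprn_ge0// ltW.
by rewrite divr_ge0//; lra.
Unshelve. all: by end_near. Qed.

End Decay.

(** * Antiderivatives on an open interval *)

Section Antiderivative.
Variable R : realType.
Notation mu := (@lebesgue_measure R).

(** The signed integral from c, written with two unsigned integrals; near a given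
    x it differs by a constant from the integral from a fixed point a' to the left
    of both c and x, to which the fundamental theorem applies. *)
Lemma antiderivative (g : R -> R) (a b c : R) : a < c -> c < b ->
  (forall x, a < x < b -> {for x, continuous g}) ->
  exists F : R -> R, forall x : R, a < x < b -> is_derive x 1 F (g x).
Proof.
move=> ac cb gc.
pose F v := \int[mu]_(t in `]c, v]) g t - \int[mu]_(t in `]v, c]) g t.
exists F => x /andP[ax xb].
pose a' := (a + Num.min c x) / 2; pose b' := (b + Num.max c x) / 2.
have [a1 a2 a3] : [/\ a < a', a' < c & a' < x].
  have := ge_min c c x; have := ge_min x c x; have : a < Num.min c x by rewrite lt_min ac.
  by rewrite !lexx orbT /= /a' => ? ? ?; split; lra.
have [b1 b2 b3] : [/\ b' < b, c < b' & x < b'].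
  have := le_max c c x; have := le_max x c x; have : Num.max c x < b by rewrite gt_max cb.
  by rewrite !lexx orbT /= /b' => ? ? ?; split; lra.
have gi v : v <= b' -> mu.-integrable `[a', v] (EFin \o g).
  move=> vb; apply: continuous_compact_integrable; first exact: segment_compact.
  apply: continuous_in_subspaceT => y; rewrite inE /= in_itv/= => /andP[y1 y2].
  by apply: gc; apply/andP; split; lra.
have [dI IE] := continuous_FTC1_closed b3 (gi _ (lexx _)) a3
  (gc x (introT andP (conj ax xb))).
set I := (fun y => _) in dI IE.
have IF v : a' < v < b' -> I v + - I c = F v.
  move=> /andP[v1 v2]; rewrite /I /F; case: (leP c v) => cv.
    rewrite Rintegral_itvB ?bnd_simp//; [|exact: gi (ltW v2)|exact: ltW].
    by rewrite [in X in _ = _ - X]set_itv_ge ?bnd_simp -?leNgt// Rintegral_set0 subr0.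
  rewrite [in X in _ = X - _]set_itv_ge ?bnd_simp -?leNgt ?(ltW cv)// Rintegral_set0 sub0r.
  rewrite -opprB Rintegral_itvB ?bnd_simp//; [exact: gi (ltW b2)|exact: ltW|exact: ltW].
apply: (near_eq_is_derive (f := fun v => I v + - I c)).
  have : x \in `]a', b'[ by rewrite in_itv /= a3 b3.
  by move=> /near_in_itvoo; apply: filterS => v; rewrite in_itv; exact: IF.
have I' : is_derive x 1 I (g x) by split; [exact: dI|rewrite -derive1E; exact: IE].
apply: (is_derive_eq (is_deriveD_fun I' (is_deriveC_fun (- I c) x))).
by rewrite addr0.
Qed.

End Antiderivative.

(** * The scalar equation v' = F(v) between two zeros of F *)

Section Flow.
Variable R : realType.

(** The function h + ln / K is nonincreasing on ]0, d]. *)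
Lemma log_divergence (h h1 : R -> R) (K d M : R) : 0 < K -> 0 < d ->
  (forall y : R, 0 < y <= d -> is_derive y 1 h (h1 y)) ->
  (forall y : R, 0 < y <= d -> h1 y <= - (K * y)^-1) ->
  exists2 y : R, 0 < y <= d & M <= h y.
Proof.
move=> K0 d0 hE hb; pose t := Num.max 0 (M - h d).
have t0 : 0 <= t by rewrite le_max lexx.
have tM : M - h d <= t by rewrite le_max lexx orbT.
pose y := d * expR (- (K * t)).
have y0 : 0 < y by rewrite mulr_gt0 ?expR_gt0.
have yd : y <= d.
  rewrite -[leRHS]mulr1 ler_pM2l// -expR0 ler_expR oppr_le0 mulr_ge0// ltW//.
exists y; first by rewrite y0.
pose k x := - (h x + K^-1 * ln x).
suff : k y <= k d.
  rewrite /k /y lnM ?posrE ?expR_gt0// expRK mulrDr mulrN mulKf ?gt_eqF//; lra.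
apply: (@derive_ge0_le _ k (fun x => - (h1 x + K^-1 * x^-1))) => // x /andP[x1 x2].
  have x0 : 0 < x by lra.
  have hx : is_derive x 1 h (h1 x) by apply: hE; rewrite x0.
  exact: (is_deriveN_fun (is_deriveD_fun hx (is_deriveZ_fun K^-1 (is_derive1_ln x0)))).
have x0 : 0 < x by lra.
have : h1 x <= - (K * x)^-1 by apply: hb; rewrite x0 ltW.
by rewrite invfM; lra.
Qed.

Variables (F : R -> R) (vm vp : R).
Hypothesis vmp : vm < vp.
Hypothesis F_gt0 : forall r, vm < r < vp -> 0 < F r.
Hypothesis F_cont : forall r, vm < r < vp -> {for r, continuous F}.

Definition travel_time (Phi : R -> R) :=
  forall r : R, vm < r < vp -> is_derive r 1 Phi (F r)^-1.

Lemma travel_time_exists : exists Phi, travel_time Phi.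
Proof.
apply: (@antiderivative _ (fun r => (F r)^-1) vm vp ((vm + vp) / 2));
  [by move: vmp; lra|by move: vmp; lra|].
move=> r rb; apply: continuousV; last exact: F_cont.
by rewrite gt_eqF// F_gt0.
Qed.

Lemma travel_time_lt Phi r s : travel_time Phi -> vm < r -> r < s -> s < vp ->
  Phi r < Phi s.
Proof.
move=> PhiE r0 rs s1.
have [|c /andP[c1 c2] e] := @mean_value _ Phi (fun r => (F r)^-1) _ _ rs.
  by move=> x /andP[x1 x2]; apply: PhiE; apply/andP; split; lra.
have Fc : 0 < (F c)^-1 by rewrite invr_gt0 F_gt0//; apply/andP; split; lra.
by rewrite -subr_gt0 e mulr_gt0//; lra.
Qed.

Lemma travel_time_inj Phi r s : travel_time Phi -> vm < r < vp -> vm < s < vp ->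
  Phi r = Phi s -> r = s.
Proof.
move=> PhiE /andP[r0 r1] /andP[s0 s1] e; apply/eqP.
case: (ltrgtP r s) => // rs.
  by have := travel_time_lt PhiE r0 rs s1; rewrite e ltxx.
by have := travel_time_lt PhiE s0 rs r1; rewrite e ltxx.
Qed.

Lemma travel_time_along Phi v : travel_time Phi -> (forall x, vm < v x < vp) ->
  (forall x : R, is_derive x 1 v (F (v x))) -> forall x, Phi (v x) = x + Phi (v 0).
Proof.
move=> PhiE vb vE x.
have E (y : R) : is_derive y 1 (fun y => Phi (v y) + - y) 0.
  apply: (is_derive_eq (is_deriveD_fun (is_derive_chain (PhiE _ (vb y)) (vE y))
    (is_deriveN_fun (is_derive_id y 1)))).
  by rewrite mulVf ?subrr// gt_eqF// F_gt0.
by have := derive_eq0_cst E x; lra.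
Qed.

Lemma flow_unique u v :
  (forall x, vm < u x < vp) -> (forall x : R, is_derive x 1 u (F (u x))) ->
  (forall x, vm < v x < vp) -> (forall x : R, is_derive x 1 v (F (v x))) ->
  exists a, forall x, u x = v (x + a).
Proof.
move=> ub uE vb vE; have [Phi PhiE] := travel_time_exists.
exists (Phi (u 0) - Phi (v 0)) => x.
apply: (travel_time_inj PhiE) => //.
by rewrite (travel_time_along PhiE ub uE) (travel_time_along PhiE vb vE); lra.
Qed.

Hypothesis F_top : exists2 K, 0 < K & exists2 d, 0 < d &
  forall y, 0 < y <= d -> F (vp - y) <= K * y.
Hypothesis F_bot : exists2 K, 0 < K & exists2 d, 0 < d &
  forall y, 0 < y <= d -> F (vm + y) <= K * y.

Lemma travel_time_top Phi M : travel_time Phi ->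
  exists2 r, vm < r < vp & M <= Phi r.
Proof.
move=> PhiE; have [K K0 [d' d'0 Fd]] := F_top.
pose d := Num.min d' ((vp - vm) / 2).
have d0 : 0 < d by rewrite lt_min d'0; move: vmp; lra.
have dd : d <= d' by rewrite ge_min lexx.
have dv : d <= (vp - vm) / 2 by rewrite ge_min lexx orbT.
have [||y /andP[y0 yd] yM] := @log_divergence (fun y => Phi (vp - y))
  (fun y => - (F (vp - y))^-1) K d M K0 d0.
- move=> y /andP[y0 yd].
  have b : vm < vp - y < vp by apply/andP; split; lra.
  apply: (is_derive_eq (is_derive_chain (g := fun y => vp - y) (PhiE _ b)
    (is_deriveD_fun (is_deriveC_fun vp y) (is_deriveN_fun (is_derive_id y 1))))).
  by rewrite add0r mulrN1.
- move=> y /andP[y0 yd].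
  have b : vm < vp - y < vp by apply/andP; split; lra.
  rewrite lerN2 lef_pV2 ?posrE ?mulr_gt0 ?F_gt0//.
  by apply: Fd; rewrite y0 /=; lra.
- by exists (vp - y) => //; apply/andP; split; lra.
Qed.

Lemma travel_time_bot Phi M : travel_time Phi ->
  exists2 r, vm < r < vp & Phi r <= M.
Proof.
move=> PhiE; have [K K0 [d' d'0 Fd]] := F_bot.
pose d := Num.min d' ((vp - vm) / 2).
have d0 : 0 < d by rewrite lt_min d'0; move: vmp; lra.
have dd : d <= d' by rewrite ge_min lexx.
have dv : d <= (vp - vm) / 2 by rewrite ge_min lexx orbT.
have [||y /andP[y0 yd] yM] := @log_divergence (fun y => - Phi (vm + y))
  (fun y => - (F (vm + y))^-1) K d (- M) K0 d0.
- move=> y /andP[y0 yd].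
  have b : vm < vm + y < vp by apply/andP; split; lra.
  apply: (is_derive_eq (is_deriveN_fun (is_derive_chain
    (g := fun y => vm + y) (PhiE _ b) (is_deriveD_fun (is_deriveC_fun vm y) (is_derive_id y 1))))).
  by rewrite add0r mulr1.
- move=> y /andP[y0 yd].
  have b : vm < vm + y < vp by apply/andP; split; lra.
  rewrite lerN2 lef_pV2 ?posrE ?mulr_gt0 ?F_gt0//.
  by apply: Fd; rewrite y0 /=; lra.
- by exists (vm + y); [apply/andP; split; lra|lra].
Qed.

Lemma travel_time_surj Phi t : travel_time Phi ->
  exists r, vm < r < vp /\ Phi r = t.
Proof.
move=> PhiE.
have [r /andP[r0 r1] rt] := travel_time_bot t PhiE.
have [s /andP[s0 s1] st] := travel_time_top t PhiE.
have rs : r <= s.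
  rewrite leNgt; apply/negP => sr.
  by have := travel_time_lt PhiE s0 sr r1; lra.
have [||c] := @IVT _ Phi r s t rs.
- apply: continuous_in_subspaceT => y; rewrite inE /= in_itv/= => /andP[y1 y2].
  by apply: (is_derive_cont (PhiE y _)); apply/andP; split; lra.
- rewrite ge_min le_max rt st orbT //.
rewrite in_itv /= => /andP[c0 c1] ct; exists c; split => //.
by apply/andP; split; lra.
Qed.

(** The solution is the inverse function of the travel time. *)
Lemma flow_exists : exists v : R -> R,
  [/\ forall x, vm < v x < vp, forall x : R, is_derive x 1 v (F (v x)),
      v x @[x --> -oo] --> vm & v x @[x --> +oo] --> vp].
Proof.
have [Phi PhiE] := travel_time_exists.
have [v vP] := choice (fun t => travel_time_surj t PhiE).
have vb x : vm < v x < vp by case: (vP x).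
have Phiv x : Phi (v x) = x by case: (vP x).
have lb r x : vm < r < vp -> Phi r < x -> r < v x.
  move=> /andP[r0 r1] rx; rewrite ltNge; apply/negP; rewrite le_eqVlt => /predU1P[e|vr].
    by move: rx; rewrite -e Phiv ltxx.
  have /andP[v0 _] := vb x.
  by have := travel_time_lt PhiE v0 vr r1; rewrite Phiv; lra.
have ub r x : vm < r < vp -> x < Phi r -> v x < r.
  move=> /andP[r0 r1] rx; rewrite ltNge; apply/negP; rewrite le_eqVlt => /predU1P[e|vr].
    by move: rx; rewrite e Phiv ltxx.
  have /andP[_ v1] := vb x.
  by have := travel_time_lt PhiE r0 vr v1; rewrite Phiv; lra.
exists v; split => //.
- move=> x; have /andP[v0 v1] := vb x.
  have near_v : \forall r \near v x, vm < r < vp.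
    have : v x \in `]vm, vp[ by rewrite in_itv /= v0.
    by move=> /near_in_itvoo; apply: filterS => r; rewrite in_itv.
  rewrite -{1}(Phiv x) -[F (v x)]invrK; apply: is_derive_inverse.
  + apply: filterS near_v => r rb.
    by apply: (travel_time_inj PhiE) => //; rewrite Phiv.
  + by apply: filterS near_v => r rb; exact: (is_derive_cont (PhiE r rb)).
  + exact: PhiE.
  + by rewrite invr_eq0 gt_eqF// F_gt0.
- apply/cvgrPdist_lt => e e0.
  pose r := vm + Num.min e (vp - vm) / 2.
  have m0 : 0 < Num.min e (vp - vm) by rewrite lt_min e0 /=; move: vmp; lra.
  have m1 : Num.min e (vp - vm) <= e by rewrite ge_min lexx.
  have m2 : Num.min e (vp - vm) <= vp - vm by rewrite ge_min lexx orbT.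
  exists (Phi r); split; first exact: num_real.
  move=> x xr; have /andP[v0 v1] := vb x.
  have vr : v x < r by apply: ub => //; rewrite /r; apply/andP; split; lra.
  by rewrite distrC gtr0_norm; rewrite /r in vr; lra.
- apply/cvgrPdist_lt => e e0.
  pose r := vp - Num.min e (vp - vm) / 2.
  have m0 : 0 < Num.min e (vp - vm) by rewrite lt_min e0 /=; move: vmp; lra.
  have m1 : Num.min e (vp - vm) <= e by rewrite ge_min lexx.
  have m2 : Num.min e (vp - vm) <= vp - vm by rewrite ge_min lexx orbT.
  exists (Phi r); split; first exact: num_real.
  move=> x xr; have /andP[v0 v1] := vb x.
  have vr : r < v x by apply: lb => //; rewrite /r; apply/andP; split; lra.
  by rewrite gtr0_norm; rewrite /r in vr; lra.
Qed.

End Flow.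

(** * The potential and the profile seen from an end state *)

Section EndStates.
Variable R : realType.

(** The derivatives of y |-> f (a + sigma * y) - f a.  With sigma = -1 for vp and
    sigma = 1 for vm, the well between the two minima lies on the side
    y > 0 in both cases. *)
Definition end_tower (f : R -> R) (a sigma : R) (k : nat) (y : R) : R :=
  sigma ^+ k * derive1n k f (a + sigma * y) - (if k is 0 then f a else 0).

Lemma affine_derive (a sigma x : R) : is_derive x 1 (fun y => a + sigma * y) sigma.
Proof.
apply: (is_derive_eq (is_deriveD_fun (is_deriveC_fun a x)
  (is_deriveZ_fun sigma (is_derive_id x 1)))).
by rewrite add0r mulr1.
Qed.

Lemma end_tower_tower f a sigma : smooth f -> derivative_tower (end_tower f a sigma).
Proof.
move=> fs k x.
have h := is_deriveD_fun (is_deriveZ_fun (sigma ^+ k) (is_derive_chain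
  (g := fun y => a + sigma * y) (smooth_tower fs k _) (affine_derive a sigma x)))
  (is_deriveC_fun (- (if k is 0 then f a else 0)) x).
apply: (is_derive_eq h).
by rewrite /end_tower exprSr /=; ring.
Qed.

Lemma end_tower0 f a sigma m : min_order f a m ->
  forall i, (i < 2 * m)%N -> end_tower f a sigma i 0 = 0.
Proof.
move=> [f0 _] [|i] im; rewrite /end_tower mulr0 addr0.
  by rewrite expr0 mul1r derive1n0 subrr.
by rewrite f0 ?mulr0 ?subr0//; lia.
Qed.

(** The order of the leading derivative is even, so the reflection keeps its
    sign. *)
Lemma end_tower_top f a sigma m : (0 < m)%N -> sigma ^+ 2 = 1 -> min_order f a m ->
  0 < end_tower f a sigma (2 * m) 0.
Proof.
move=> m0 s2 [_ ft]; rewrite /end_tower mulr0 addr0 exprM s2 expr1n mul1r.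
by case: m m0 ft => // m _; rewrite mulnS subr0.
Qed.

(** The decay of [profile_decay] for z x = sigma * (v (- sigma * x) - a), the
    reflection in time making the end state a the limit at + oo. *)
Lemma end_state_decay (f v : R -> R) (a sigma : R) (m : nat) :
  sigma ^+ 2 = 1 -> smooth f -> smooth v -> (0 < m)%N -> min_order f a m ->
  (forall x, derive1n 2 v x = derive1 f (v x)) ->
  (forall x, derive1 v x ^+ 2 = 2 * (f (v x) - f a)) ->
  (forall x, 0 < derive1 v x) -> (forall x, 0 < sigma * (v x - a)) ->
  v (- sigma * x) @[x --> +oo] --> a ->
  exists2 c : R, 0 < c & forall k : nat, exists2 C : R, 0 < C &
    \forall x \near +oo, `|derive1n k (fun y => v y - a) (- sigma * x)| <=
      if m == 1%N then C * expR (- (c * `|x|))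
      else C * (1 + `|x|) `^ (- (1 / (m%:R - 1)) - k%:R).
Proof.
move=> s2 fs vs m0 fm v2f v1f v10 va vl.
pose K k y := derive1n k v y - (if k is 0 then a else 0).
have KE : derivative_tower K.
  move=> k x.
  have h := is_deriveD_fun (smooth_tower vs k x)
    (is_deriveC_fun (- (if k is 0 then a else 0)) x).
  by apply: (is_derive_eq h); rewrite /K addr0 subr0.
pose Z k x := sigma * (- sigma) ^+ k * K k (0 + - sigma * x).
have ZE : derivative_tower Z.
  move=> k x.
  have h := is_deriveZ_fun (sigma * (- sigma) ^+ k) (is_derive_chain
    (g := fun y => 0 + - sigma * y) (KE k _) (affine_derive 0 (- sigma) x)).
  by apply: (is_derive_eq h); rewrite /Z exprSr /=; ring.
have Z0 x : Z 0%N x = sigma * (v (- sigma * x) - a).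
  by rewrite /Z expr0 mulr1 add0r /K derive1n0.
have vZ x : a + sigma * Z 0%N x = v (- sigma * x).
  by rewrite Z0 mulrA -expr2 s2 mul1r; ring.
have Z1 x : Z 1%N x = - derive1 v (- sigma * x).
  by rewrite /Z expr1 mulrN -expr2 s2 /K derive1n1 add0r subr0 mulN1r.
have Z2 x : Z 2%N x = end_tower f a sigma 1 (Z 0%N x).
  rewrite /end_tower vZ /Z sqrrN s2 mulr1 /K add0r !subr0 expr1.
  by rewrite v2f derive1n1.
have Zl : Z 0%N x @[x --> +oo] --> 0.
  rewrite (_ : Z 0%N = fun x => sigma * (v (- sigma * x) - a)); last exact/funext.
  by rewrite -[X in _ --> X](mulr0 sigma) -(subrr a); apply: cvgMr; apply: cvgB => //;
    exact: cvg_cst.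
have Z2E (x : R) : is_derive x 1 (Z 1%N) (end_tower f a sigma 1 (Z 0%N x)).
  by rewrite -Z2; exact: ZE.
have Z_gt0 x : 0 < Z 0%N x by rewrite Z0.
have Z1_lt0 x : Z 1%N x < 0 by rewrite Z1 oppr_lt0.
have energy x : Z 1%N x ^+ 2 = 2 * end_tower f a sigma 0 (Z 0%N x).
  by rewrite Z1 sqrrN v1f /end_tower vZ expr0 mul1r derive1n0.
have [c c0 hc] := profile_decay (end_tower_tower a sigma fs) (ZE 0%N) Z2E m0
  (end_tower0 sigma fm) Z_gt0 Z1_lt0 Zl energy (end_tower_top m0 s2 fm).
exists c => // k; have [C C0 kC] := hc k; exists C => //.
apply: filterS kC => x; rewrite (tower_derive1n k ZE).
have -> : (fun y => v y - a) = K 0%N by apply/funext => y; rewrite /K derive1n0.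
rewrite (tower_derive1n k KE) /Z add0r !normrM normrX normrN.
have -> : `|sigma| = 1.
  by apply/eqP; rewrite -(@eqrXn2 _ 2)// real_normK ?num_real// s2 expr1n.
by rewrite expr1n !mul1r.
Qed.

Lemma increasing_between (v v1 : R -> R) (a b : R) :
  (forall x : R, is_derive x 1 v (v1 x)) -> (forall x, 0 < v1 x) ->
  v x @[x --> -oo] --> a -> v x @[x --> +oo] --> b -> forall x, a < v x < b.
Proof.
move=> vE v10 va vb x.
have v_lt y z : y < z -> v y < v z.
  move=> yz; have [c _ e] := mean_value yz (fun x _ => vE x).
  by rewrite -subr_gt0 e mulr_gt0// subr_gt0.
apply/andP; split; rewrite ltNge; apply/negP => h.
  have : v (x - 1) < a by apply: lt_le_trans h; apply: v_lt; lra.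
  move=> /(cvgr_gt a va)[X [_ hX]].
  have := hX (Num.min X (x - 1) - 1); rewrite /=.
  have mX : Num.min X (x - 1) <= X by rewrite ge_min lexx.
  have mx : Num.min X (x - 1) <= x - 1 by rewrite ge_min lexx orbT.
  have lX : Num.min X (x - 1) - 1 < X by lra.
  have lx : Num.min X (x - 1) - 1 < x - 1 by lra.
  by move=> /(_ lX) h2; have := v_lt _ _ lx; lra.
have : b < v (x + 1) by apply: le_lt_trans h _; apply: v_lt; lra.
move=> /(cvgr_lt b vb)[X [_ hX]].
have := hX (Num.max X (x + 1) + 1); rewrite /=.
have mX : X <= Num.max X (x + 1) by rewrite le_max lexx.
have mx : x + 1 <= Num.max X (x + 1) by rewrite le_max lexx orbT.
have lX : X < Num.max X (x + 1) + 1 by lra.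
have lx : x + 1 < Num.max X (x + 1) + 1 by lra.
by move=> /(_ lX) h2; have := v_lt _ _ lx; lra.
Qed.

(** Positivity of D on the matrix unit with entry 1 at the place (1, 1). *)
Lemma elasticity_tensor_gt0 (n : nat) (D : 'I_n.+1 -> 'I_n.+1 -> 'M[R]_n.+1) :
  elasticity_tensor D -> 0 < D ord0 ord0 ord0 ord0.
Proof.
move=> [_ _ _ [c0 c00 hc]]; pose A : 'M[R]_n.+1 := delta_mx ord0 ord0.
have ddotA B : ddot B A = B ord0 ord0.
  rewrite /ddot (bigD1 ord0)//= (bigD1 ord0)//= mxE !eqxx mulr1 !big1 ?addr0//.
    by move=> i i0; rewrite big1// => j _; rewrite mxE (negPf i0) mulr0.
  by move=> j j0; rewrite mxE eqxx (negPf j0) mulr0.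
have Asym : symm A by rewrite /symm trmx_delta.
have := hc A Asym; rewrite ddotA mxE.
have -> : \sum_(k < n.+1) \sum_(l < n.+1) D ord0 ord0 k l * A k l = D ord0 ord0 ord0 ord0.
  exact: ddotA.
apply: lt_le_trans; rewrite mulr_gt0// exprn_gt0// sqrtr_gt0 ddotA mxE eqxx.
exact: ltr01.
Qed.

End EndStates.

(** * Traveling waves of the system *)

Section Waves.
Variable R : realType.
Variables (f : R -> R) (vm vs vp : R) (m1 m2 : nat).
Hypothesis vms : vm < vs.
Hypothesis vsp : vs < vp.
Hypothesis well : double_well f vm vs vp.
Hypothesis m1_gt0 : (0 < m1)%N.
Hypothesis m2_gt0 : (0 < m2)%N.
Hypothesis fp : min_order f vp m1.
Hypothesis fm : min_order f vm m2.

Let fs : smooth f. Proof. by case: well. Qed.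

Let fE (x : R) : is_derive x 1 f (derive1 f x).
Proof. exact: (smooth_tower fs 0). Qed.

Let vmp : vm < vp. Proof. exact: lt_trans vms vsp. Qed.

Lemma min_order_derive1 a m : (0 < m)%N -> min_order f a m -> derive1 f a = 0.
Proof. by move=> m0 [h _]; rewrite -derive1n1; apply: h; move: m0; lia. Qed.

Section OneWave.
Variables (n : nat) (D : 'I_n.+1 -> 'I_n.+1 -> 'M[R]_n.+1).
Variables (eps0 eps1 : 'M[R]_n.+1) (T11 s wm wp : R) (v w : R -> R).
Hypothesis vw : traveling_wave D eps0 eps1 T11 f s vm vp wm wp v w.

Let vsm : smooth v. Proof. by case: vw => -[]. Qed.

Let v10 x : 0 < derive1 v x. Proof. by case: vw. Qed.

Let vlm : v x @[x --> -oo] --> vm. Proof. by case: vw => _ _ []. Qed.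

Let vlp : v x @[x --> +oo] --> vp. Proof. by case: vw => _ _ []. Qed.

Let vE (x : R) : is_derive x 1 v (derive1 v x).
Proof. exact: (smooth_tower vsm 0). Qed.

Lemma wave_between x : vm < v x < vp.
Proof. exact: (increasing_between vE v10 vlm vlp). Qed.

(** The second equation along the line t = 0, which carries the whole
    profile; the absolute value disappears because v' > 0. *)
Lemma wave_flux (x : R) :
  is_derive x 1 (fun y => (- (derive1n 2 f (v y) * derive1 v y) + derive1n 3 v y)
                          * derive1 v y) (s * derive1 v x).
Proof.
case: vw => _ [u _ sol] _ _ _; have [_ _ [_ dJ] _ eJ] := sol x 0.
have V0 : (fun y => v (y - s * 0)) = v.
  by apply/funext => y; rewrite mulr0 subr0.
have JE : (fun y => flux f (fun x t => v (x - s * t)) y 0) =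
  (fun y => (- (derive1n 2 f (v y) * derive1 v y) + derive1n 3 v y) * derive1 v y).
  apply/funext => y; rewrite /flux V0 gtr0_norm//; congr (_ * _).
  rewrite (_ : (fun y => _) = fun y => - derive1 f (v y) + derive1n 2 v y); last first.
    by apply/funext => t; rewrite mulr0 subr0.
  apply: is_derive_derive1; apply: is_deriveD_fun; last exact: (smooth_tower vsm 2).
  apply: is_deriveN_fun; apply: is_derive_chain (vE y).
  exact: (smooth_tower fs 1).
have Vt : is_derive (0 : R) 1 (fun t => v (x - s * t)) (- s * derive1 v x).
  have E := affine_derive x (- s) 0.
  have e : (fun t => x + - s * t) = (fun t => x - s * t).
    by apply/funext => t; rewrite mulNr.
  rewrite e in E.
  have h := is_derive_chain (g := fun t => x - s * t) (vE (x - s * 0)) E.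
  by apply: (is_derive_eq h); rewrite mulr0 subr0 mulrC.
rewrite (is_derive_derive1 Vt) in eJ.
rewrite -JE; have := derivableP dJ; rewrite -derive1E => h.
by apply: (is_derive_eq h); lra.
Qed.

Lemma wave_newton :
  [/\ s = 0, forall x, derive1n 2 v x = derive1 f (v x),
      forall x, derive1 v x ^+ 2 = 2 * (f (v x) - f vp) &
      forall x, derive1 v x ^+ 2 = 2 * (f (v x) - f vm)].
Proof.
exact: (wave_first_integrals fE (smooth_tower fs 1%N)
  (min_order_derive1 m2_gt0 fm) (min_order_derive1 m1_gt0 fp) vmp
  vE (smooth_tower vsm 1%N) (smooth_tower vsm 2%N) vlm vlp v10 wave_between wave_flux).
Qed.

Lemma wave_levels : f vp = f vm.
Proof. by case: wave_newton => _ _ /(_ 0) + /(_ 0) => -> ?; lra. Qed.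

Lemma wave_speed (x : R) : is_derive x 1 v (Num.sqrt (2 * (f (v x) - f vm))).
Proof.
apply: (is_derive_eq (vE x)).
by case: wave_newton => _ _ _ <-; rewrite sqrtr_sqr gtr0_norm.
Qed.

Lemma wave_stress x : T11 = stress11 D eps0 eps1 (w x) (v x).
Proof.
case: vw => _ [u uE sol] _ _ _; have [_ _ _ + _] := sol x 0.
by rewrite uE mulr0 subr0.
Qed.

(** The first equation is continuous in (w, v), so it passes to the limit. *)
Lemma wave_end_stress :
  T11 = stress11 D eps0 eps1 wm vm /\ T11 = stress11 D eps0 eps1 wp vp.
Proof.
case: vw => _ _ _ [wlm wlp] _.
have lim F (FF : ProperFilter F) a b : w x @[x --> F] --> a -> v x @[x --> F] --> b ->
    T11 = stress11 D eps0 eps1 a b.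
  move=> wa vb.
  have h : stress11 D eps0 eps1 (w x) (v x) @[x --> F] --> stress11 D eps0 eps1 a b.
    by apply: cvgB; [apply: cvgB; [exact: cvgMr|exact: cvg_cst]|exact: cvgMr].
  have e : (fun x => stress11 D eps0 eps1 (w x) (v x)) = cst T11.
    by apply/funext => x; rewrite -wave_stress.
  rewrite e in h.
  exact: (cvg_unique _ (cvg_cst T11) h).
by split; apply: lim; eauto; exact: _.
Qed.

Lemma wave_decay : decay_at +oo v vp m1 /\ decay_at -oo v vm m2.
Proof.
have [_ v2f v1p v1m] := wave_newton; split.
- have s2 : (- 1) ^+ 2 = 1 :> R by rewrite sqrrN expr1n.
  have va x : 0 < - 1 * (v x - vp) by have := wave_between x; lra.
  have vl : v (- (- 1) * x) @[x --> +oo] --> vp.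
    by rewrite (_ : (fun x => _) = v)//; apply/funext => x; rewrite opprK mul1r.
  have [c c0 hc] := end_state_decay s2 fs vsm m1_gt0 fp v2f v1p v10 va vl.
  exists c => // k; have [C C0 kC] := hc k; exists C => //.
  by apply: filterS kC => x; rewrite opprK mul1r.
- have s2 : 1 ^+ 2 = 1 :> R by rewrite expr1n.
  have va x : 0 < 1 * (v x - vm) by have := wave_between x; lra.
  have vl : v (- 1 * x) @[x --> +oo] --> vm.
    rewrite (_ : (fun x => _) = fun x => v (- x)); first by apply/cvgNy_compNP.
    by apply/funext => x; rewrite mulN1r.
  have [c c0 hc] := end_state_decay s2 fs vsm m2_gt0 fm v2f v1m v10 va vl.
  exists c => // k; have [C C0 [X [_ kC]]] := hc k; exists C => //.
  exists (- X); split; first exact: num_real.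
  move=> x /= xX; have := kC (- x); rewrite /= mulN1r opprK normrN.
  by apply; lra.
Qed.

End OneWave.

Lemma well_above r : f vp = f vm -> vm < r < vp -> f vm < f r.
Proof.
move=> fpm /andP[r0 r1]; have [_ _ _ f_inc f_dec] := well.
have := vms; have := vsp => s1 s0.
case: (leP r vs) => rs.
  have [c /andP[c0 c1] e] := mean_value r0 (fun x _ => fE x).
  have : 0 < derive1 f c by apply: f_inc; apply/andP; split; lra.
  by move=> h; rewrite -subr_gt0 e mulr_gt0// subr_gt0.
have [c /andP[c0 c1] e] := mean_value r1 (fun x _ => fE x).
have h : derive1 f c < 0 by apply: f_dec; apply/andP; split; lra.
rewrite -fpm -subr_lt0 -opprB oppr_lt0 -oppr_lt0 opprB e pmulr_llt0//; lra.
Qed.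

Definition speed (r : R) : R := Num.sqrt (2 * (f r - f vm)).

Lemma speed_gt0 r : f vp = f vm -> vm < r < vp -> 0 < speed r.
Proof. by move=> e rb; rewrite sqrtr_gt0; have := well_above e rb; lra. Qed.

Lemma speed_derive (r : R) : f vp = f vm -> vm < r < vp ->
  is_derive r 1 speed (derive1 f r / speed r).
Proof.
move=> e rb; have r0 : 0 < 2 * (f r - f vm) by have := well_above e rb; lra.
have h := is_derive_chain (g := fun r => 2 * (f r - f vm)) (is_derive1_sqrt r0)
  (is_deriveZ_fun 2 (is_deriveD_fun (fE r) (is_deriveC_fun (- f vm) r))).
apply: (is_derive_eq h); rewrite -/(speed r); have s0 := speed_gt0 e rb.
by field; rewrite gt_eqF.
Qed.

(** The function f - f vm vanishes to order 2 at both wells, as m > 0 makes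
    the first derivative vanish there. *)
Lemma speed_end a sigma m : (0 < m)%N -> min_order f a m -> f a = f vm ->
  exists2 K, 0 < K & exists2 d, 0 < d &
    forall y, 0 < y <= d -> speed (a + sigma * y) <= K * y.
Proof.
move=> m0 fa fam.
have [|C C0 [d d0 h]] := tower_bigO (p := 2) (end_tower_tower a sigma fs).
  by move=> i i2; apply: (end_tower0 sigma fa); move: m0; lia.
exists (Num.sqrt (2 * C)); first by rewrite sqrtr_gt0; lra.
exists d => // y /andP[y0 yd].
rewrite -[in leRHS](ger0_norm (ltW y0)) -sqrtr_sqr -sqrtrM; last lra.
rewrite ler_wsqrtr//.
have : `|end_tower f a sigma 0 y| <= C * y ^+ 2 by apply: h; rewrite ltW.
rewrite /end_tower expr0 mul1r derive1n0 fam.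
by have := ler_norm (f (a + sigma * y) - f vm); lra.
Qed.

(** The flow of [speed] satisfies v'' = f'(v), which makes it smooth and its
    flux zero.  The displacement is independent of time and is found as a function
    of v: Psi (v) has derivative w as soon as Psi' = w / speed. *)
Lemma wave_exists (n : nat) (D : 'I_n.+1 -> 'I_n.+1 -> 'M[R]_n.+1)
    (eps0 eps1 : 'M[R]_n.+1) (T11 wm wp : R) :
  0 < D ord0 ord0 ord0 ord0 -> f vp = f vm ->
  T11 = stress11 D eps0 eps1 wm vm -> T11 = stress11 D eps0 eps1 wp vp ->
  exists v w : R -> R, traveling_wave D eps0 eps1 T11 f 0 vm vp wm wp v w.
Proof.
move=> D0 fpm Tm Tp.
have s_gt0 r : vm < r < vp -> 0 < speed r by exact: speed_gt0.
have s_cont r : vm < r < vp -> {for r, continuous speed}.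
  by move=> rb; exact: (is_derive_cont (speed_derive fpm rb)).
have [|| v [vb vE vlm vlp]] := flow_exists vmp s_gt0 s_cont.
- have [K K0 [d d0 h]] := speed_end (- 1) m1_gt0 fp fpm.
  by exists K => //; exists d => // y /h; rewrite mulN1r.
- have [K K0 [d d0 h]] := speed_end 1 m2_gt0 fm (erefl _).
  by exists K => //; exists d => // y /h; rewrite mul1r.
have v1 : derive1 v = fun x => speed (v x).
  by apply/funext => x; exact: is_derive_derive1.
have v1E (x : R) : is_derive x 1 (fun x => speed (v x)) (derive1 f (v x)).
  have h := is_derive_chain (speed_derive fpm (vb x)) (vE x).
  by apply: (is_derive_eq h); rewrite divfK// gt_eqF// s_gt0.
have v2 : derive1n 2 v = fun x => derive1 f (v x).
  by apply/funext => x; rewrite derive1nS derive1n1 v1; exact: is_derive_derive1.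
have vsm : smooth v.
  exact: (@profile_smooth _ (fun k => derive1n k f) v _ 1 (smooth_tower fs) vE v1E).
set d := D ord0 ord0 ord0 ord0 in D0.
pose e0 := ddot (D ord0 ord0) eps0; pose e1 := ddot (D ord0 ord0) eps1.
(* the first equation solved for u_x, as a function of the value r of v *)
pose om r := d^-1 * (T11 + e0) + d^-1 * e1 * r.
have omE r q : T11 = stress11 D eps0 eps1 q r <-> om r = q.
  rewrite /stress11 -/d -/e0 -/e1 /om; split => [->|<-]; field; exact: lt0r_neq0.
have om_cont r : {for r, continuous om}.
  exact: (is_derive_cont (affine_derive _ _ r)).
pose w x := om (v x).
have [Psi PsiE] : exists Psi : R -> R, forall r : R, vm < r < vp ->
    is_derive r 1 Psi (om r / speed r).
  apply: (@antiderivative _ (fun r => om r / speed r) _ _ vs vms vsp) => r rb.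
  apply: cvgM; first exact: om_cont.
  by apply: cvgV; [rewrite gt_eqF// s_gt0|exact: s_cont].
have uE (x : R) : is_derive x 1 (fun x => Psi (v x)) (w x).
  have h := is_derive_chain (PsiE _ (vb x)) (vE x).
  by apply: (is_derive_eq h); rewrite divfK// gt_eqF// s_gt0.
have wsm : smooth w.
  pose W k x := d^-1 * e1 * derive1n k v x + (if k is 0 then d^-1 * (T11 + e0) else 0).
  have WE : derivative_tower W.
    move=> k x.
    have h := is_deriveD_fun (is_deriveZ_fun (d^-1 * e1) (smooth_tower vsm k x))
      (is_deriveC_fun (if k is 0 then d^-1 * (T11 + e0) else 0) x).
    by apply: (is_derive_eq h).
  have -> : w = W 0%N by apply/funext => x; rewrite /w /om /W derive1n0 addrC.
  exact: tower_smooth.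
have w_lim (F : set_system R) (FF : Filter F) a q : T11 = stress11 D eps0 eps1 q a ->
    v x @[x --> F] --> a -> w x @[x --> F] --> q.
  by move=> /omE <- va; exact: cvg_comp_continuous.
exists v, w; split.
- by split.
- exists (fun x _ => Psi (v x)).
    by move=> x t; rewrite mul0r subr0; exact: is_derive_derive1.
  have -> : (fun x t : R => v (x - 0 * t)) = (fun x _ => v x).
    by apply/funext => x; apply/funext => t; rewrite mul0r subr0.
  have J0 : flux f (fun x _ : R => v x) = fun _ _ => 0.
    apply/funext => x; apply/funext => t; rewrite /flux.
    have -> : (fun y : R => - derive1 f (v y) + derive1n 2 v y) = cst 0.
      by apply/funext => y; rewrite v2 addNr.
    by rewrite (is_derive_derive1 (is_deriveC_fun 0 x)) mul0r.
  move=> x t; split.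
  + by case: (uE x).
  + by move=> k _; exact: vsm.
  + by rewrite J0; split; exact: derivable_cst.
  + by rewrite (is_derive_derive1 (uE x)); apply/omE.
  + rewrite J0 (is_derive_derive1 (is_deriveC_fun (v x) t)).
    by rewrite (is_derive_derive1 (is_deriveC_fun 0 x)) oppr0.
- by split.
- by split; [exact: w_lim Tm vlm|exact: w_lim Tp vlp].
- by move=> x; rewrite v1 s_gt0.
Qed.

End Waves.


Theorem theorem3p2 (R : realType) (n : nat)
    (D : 'I_n.+1 -> 'I_n.+1 -> 'M[R]_n.+1) (eps0 eps1 : 'M[R]_n.+1)
    (f : R -> R) (vm vs vp : R) (m1 m2 : nat) (T11 : R) :
  elasticity_tensor D -> symm eps0 -> symm eps1 ->
  vm < vs -> vs < vp -> double_well f vm vs vp ->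
  (0 < m1)%N -> (0 < m2)%N -> min_order f vp m1 -> min_order f vm m2 ->
  [/\ (* existence; the last conjunct on the right says that the end state
         (vm, wm) is compatible with the prescribed T11 *)
      forall s wm wp : R,
        (exists v w : R -> R,
           traveling_wave D eps0 eps1 T11 f s vm vp wm wp v w) <->
        [/\ s = 0, f vp = f vm,
            D ord0 ord0 ord0 ord0 * (wp - wm) =
              ddot (D ord0 ord0) eps1 * (vp - vm)
          & T11 = stress11 D eps0 eps1 wm vm],
      (* uniqueness up to a translation *)
      forall (s wm wp : R) (v w v' w' : R -> R),
        traveling_wave D eps0 eps1 T11 f s vm vp wm wp v w ->
        traveling_wave D eps0 eps1 T11 f s vm vp wm wp v' w' ->
        exists a : R, forall x, v' x = v (x + a) /\ w' x = w (x + a)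
    & (* decay estimates *)
      forall (s wm wp : R) (v w : R -> R),
        traveling_wave D eps0 eps1 T11 f s vm vp wm wp v w ->
        decay_at +oo v vp m1 /\ decay_at -oo v vm m2].
Proof.
move=> De _ _ vms vsp well m10 m20 fp fm.
have D0 := elasticity_tensor_gt0 De; split.
- move=> s wm wp; split => [[v [w vw]]|[-> fpm rel Tm]].
    have [s0 _ _ _] := wave_newton vms vsp well m10 m20 fp fm vw.
    have [Tm Tp] := wave_end_stress vw.
    split => //; first exact: (wave_levels vms vsp well m10 m20 fp fm vw).
    by move: Tp; rewrite Tm /stress11; lra.
  apply: (wave_exists vms vsp well m10 m20 fp fm D0 fpm Tm).
  by move: rel; rewrite Tm /stress11; lra.
- move=> s wm wp v w v' w' vw vw'.
  have fpm := wave_levels vms vsp well m10 m20 fp fm vw.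
  have vE := wave_speed vms vsp well m10 m20 fp fm vw.
  have vE' := wave_speed vms vsp well m10 m20 fp fm vw'.
  have [a va] := flow_unique (lt_trans vms vsp)
    (fun r rb => speed_gt0 vms vsp well fpm rb)
    (fun r rb => is_derive_cont (speed_derive vms vsp well fpm rb))
    (wave_between vw') vE' (wave_between vw) vE.
  exists a => x; split; first exact: va.
  have := wave_stress vw' x; rewrite (wave_stress vw (x + a)) va /stress11 => e.
  by apply: (mulfI (lt0r_neq0 D0)); lra.
- by move=> s wm wp v w; exact: (wave_decay vms vsp well m10 m20 fp fm).
Qed.
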